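(* Let $A \in \mathcal M_d(\mathbb R)$, and let $\lambda$ satisfy the regularity assumption stated in the context, with associated $T_0$, $X_0$, $R$, $\tau$, $\beta_0$, $\beta_1$ as in the context. If $u \in C^0(\mathbb R_+ \times [0, 1], \mathbb R^d) \cap C^1(\mathbb R_+^\ast \times (0, 1), \mathbb R^d)$ is a classical solution of $$\left\{\begin{aligned} & \partial_t u(t, x) + \lambda(t, x) \partial_x u(t, x) = 0, & \quad & t > 0,\ x \in (0, 1), \\ & u(t, 0) = A u(t, 1), & & t \geq 0, \\ & u(0, x) = u_0(x), & & x \in [0, 1], \end{aligned}\right. \tag{T}$$ with initial condition $u_0$, then the function $v \in C^0([-T_0, +\infty), \mathbb R^d)$ defined by $v(t) = u(t, 0)$ if $t \geq 0$ and $v(t) = u_0(X_0(t, 0))$ if $t \in [-T_0, 0)$ is a continuous solution of $$\left\{\begin{aligned} v(t) & = A v(t - \tau(t)), & \qquad & t \geq 0, \\ v(t) & = v_0(t), & & t \in [-T_0, 0), \end{aligned}\right. \tag{D}$$ with $v_0(t) = u_0(X_0(t, 0))$ for $t \in [-T_0, 0)$, and in addition $v \in C^1((-T_0, +\infty), \mathbb R^d)$. Conversely, if $v \in C^0([-T_0, +\infty), \mathbb R^d) \cap C^1((-T_0, +\infty), \mathbb R^d)$ is a continuous solution of (D), then the function $u\colon \mathbb R_+ \times [0, 1] \to \mathbb R^d$ defined by $u(t, x) = v(R(t, x))$ is a classical solution of (T) with initial condition $u_0(x) = v(R(0, x))$, $x \in [0, 1]$. In addition, for $u$ and $v$ so related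 and for every $t \geq 0$, we have $$\lVert u(t, \cdot)\rVert_{L^\infty([0, 1], \mathbb R^d)} = \lVert v_t\rVert_{L^\infty([-\tau(t), 0], \mathbb R^d)}$$ and, for every $t \geq 0$ and $p \in [1, +\infty)$, $$\beta_1^{-1/p} \lVert v_t\rVert_{L^p([-\tau(t), 0], \mathbb R^d)} \leq \lVert u(t, \cdot)\rVert_{L^p([0, 1], \mathbb R^d)} \leq \beta_0^{-1/p} \lVert v_t\rVert_{L^p([-\tau(t), 0], \mathbb R^d)}.$$
   Context: $\mathbb R_+ = [0, +\infty)$, $\mathbb R_+^\ast = (0, +\infty)$; $\mathcal M_d(\mathbb R)$ is the set of real $d \times d$ matrices, $d$ a positive integer. Assumption on $\lambda$: there exist positive constants $\lambda_{\min} \leq \lambda_{\max}$ and $L$ such that $\lambda \in C^0(\mathbb R^2, [\lambda_{\min}, \lambda_{\max}])$, $\lambda = \lambda(t,x)$ is differentiable with respect to its second variable $x$, and $\partial_x \lambda \in C^0(\mathbb R^2, [-L, L])$. The flow of $\lambda$ is the unique function $\Phi \in C^1(\mathbb R^3, \mathbb R)$ with $\partial_t \Phi(t, t_0, x_0) = \lambda(t, \Phi(t, t_0, x_0))$ and $\Phi(t_0, t_0, x_0) = x_0$ for all $(t, t_0, x_0) \in \mathbb R^3$. $T_0 > 0$ is the unique positive number such that $\Phi(-T_0, 0, 1) = 0$. $X_0 \in C^1(\mathbb R^2, \mathbb R)$ is $X_0(t, x) = \Phi(0, t, x)$; it satisfies $X_0(t, 0) \in [0, 1]$ for $t \in [-T_0,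 0]$. For $(t, x) \in \mathbb R^2$, $R(t, x)$ is the unique real number with $\Phi(R(t, x), t, x) = 0$; $R \in C^1(\mathbb R^2, \mathbb R)$ and $R$ maps $\mathbb R_+ \times [0, 1]$ into $[-T_0, +\infty)$. $\tau\colon \mathbb R \to \mathbb R$ is $\tau(t) = t - R(t, 1)$; it is $C^1$ with values in $[1/\lambda_{\max}, 1/\lambda_{\min}]$, and $t - \tau(t) \geq -T_0$ for $t \geq 0$. $\beta_0, \beta_1$ are positive constants such that $\beta_0 \leq \lvert\partial_x R(t, x)\rvert \leq \beta_1$ for every $(t, x) \in \mathbb R_+ \times (0, 1)$ (such constants exist). A \emph{classical solution} of (T) with initial condition $u_0\colon [0,1] \to \mathbb R^d$ is a function $u \in C^0(\mathbb R_+ \times [0, 1], \mathbb R^d) \cap C^1(\mathbb R_+^\ast \times (0, 1), \mathbb R^d)$ satisfying the three equalities of (T) in their respective domains. A continuous solution of (D) is a continuous function $v\colon [-T_0, +\infty) \to \mathbb R^d$ satisfying (D). For $t \geq 0$, $v_t(s) = v(t + s)$ for $s \in [-\tau(t), 0]$. *)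

(* Defs.v *)
From HB Require Import structures.
From mathcomp Require Import all_boot all_order all_algebra.
From mathcomp Require Import all_classical all_reals all_analysis.

Set Implicit Arguments.
Unset Strict Implicit.
Unset Printing Implicit Defensive.

Import Order.TTheory GRing.Theory Num.Theory.
Import numFieldNormedType.Exports.

Local Open Scope classical_set_scope.
Local Open Scope ring_scope.

(* A function on a subset of R or R * R is encoded by a total function whose
   values outside that subset are irrelevant. *)

Section C1.
Context (R : realType) (V W : normedModType R).

(* O is meant to be open and V finite-dimensional: continuity of every
   directional derivative is then continuity of the differential. *)
Definition C1_on (O : set V) (f : V -> W) : Prop :=
  forall x, O x -> differentiable f x /\
    forall h : V, {for x, continuous (fun y => 'D_h f y)}.

End C1.

Section partial_derivatives.
Context (R : realType) (W : normedModType R).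

Definition partial_t (f : R * R -> W) (t x : R) : W :=
  derive1 (fun s : R => f (s, x)) t.

Definition partial_x (f : R * R -> W) (t x : R) : W :=
  derive1 (fun y : R => f (t, y)) x.

End partial_derivatives.

Section transport.
Context (R : realType).

Definition admissible_speed (lmin lmax L : R) (lam : R * R -> R) : Prop :=
  [/\ 0 < lmin, lmin <= lmax, 0 < L, continuous lam &
      forall p, lmin <= lam p <= lmax] /\
  [/\ forall t x : R, derivable (fun y : R => lam (t, y)) x 1,
      continuous (fun p : R * R => partial_x lam p.1 p.2) &
      forall t x : R, - L <= partial_x lam t x <= L].

(* Phi ((t, t0), x0) is the position at time t of the characteristic which is
   at x0 at time t0. *)
Definition is_flow (lam : R * R -> R) (Phi : R * R * R -> R) : Prop :=
  C1_on [set: R * R * R] Phi /\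
  forall t t0 x0 : R,
    derive1 (fun s : R => Phi (s, t0, x0)) t = lam (t, Phi (t, t0, x0)) /\
    Phi (t0, t0, x0) = x0.

Definition X0 (Phi : R * R * R -> R) (p : R * R) : R := Phi (0, p.1, p.2).

(* hit (t, x) is the time at which the characteristic through (t, x) is at 0;
   it is unique since the speed is positive. *)
Definition is_hitting_time (Phi : R * R * R -> R) (hit : R * R -> R) : Prop :=
  forall t x : R, Phi (hit (t, x), t, x) = 0.

Definition tau (hit : R * R -> R) (t : R) : R := t - hit (t, 1).

Context (d : nat).

Definition classical_solution (lam : R * R -> R) (A : 'M[R]_d)
    (u0 : R -> 'cV[R]_d) (u : R * R -> 'cV[R]_d) : Prop :=
  [/\ {within [set p : R * R | 0 <= p.1 /\ 0 <= p.2 <= 1], continuous u},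
      C1_on [set p : R * R | 0 < p.1 /\ 0 < p.2 < 1] u,
      forall t x : R, 0 < t -> 0 < x < 1 ->
        partial_t u t x + lam (t, x) *: partial_x u t x = 0,
      forall t : R, 0 <= t -> u (t, 0) = A *m u (t, 1) &
      forall x : R, 0 <= x <= 1 -> u (0, x) = u0 x].

Definition continuous_solution (A : 'M[R]_d) (T0 : R) (tau : R -> R)
    (v0 v : R -> 'cV[R]_d) : Prop :=
  [/\ {within `[- T0, +oo[, continuous v},
      forall t : R, 0 <= t -> v t = A *m v (t - tau t) &
      forall t : R, - T0 <= t < 0 -> v t = v0 t].

Definition v_from_u (Phi : R * R * R -> R) (T0 : R)
    (u0 : R -> 'cV[R]_d) (u : R * R -> 'cV[R]_d) (v : R -> 'cV[R]_d) : Prop :=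
  (forall t : R, 0 <= t -> v t = u (t, 0)) /\
  (forall t : R, - T0 <= t < 0 -> v t = u0 (X0 Phi (t, 0))).

Definition u_from_v (hit : R * R -> R)
    (v : R -> 'cV[R]_d) (u : R * R -> 'cV[R]_d) : Prop :=
  forall t x : R, 0 <= t -> 0 <= x <= 1 -> u (t, x) = v (hit (t, x)).

Definition is_norm (N : 'cV[R]_d -> R) : Prop :=
  [/\ forall y z, N (y + z) <= N y + N z,
      forall (a : R) y, N (a *: y) = `|a| * N y &
      forall y, N y = 0 -> y = 0].

(* Norm of f in L^p([a, b], R^d), for p in [1, +oo], where R^d carries the
   norm N; as N o f is nonnegative, extending it by zero outside [a, b]
   changes neither the integral nor the essential supremum. *)
Definition LpNorm (N : 'cV[R]_d -> R) (p : \bar R) (a b : R)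
    (f : R -> 'cV[R]_d) : \bar R :=
  'N[@lebesgue_measure R]_p [(fun s => (N (f s))%:E) \_ `[a, b]].

End transport.

(* Main.v *)
(* The solution u is constant along the characteristics s |-> Phi (s, t, x), and
   the one through (t, x) meets x = 0 at time hit (t, x): hence
   u (t, x) = v (hit (t, x)) in both directions, and everything else is
   transport of regularity and of norms through this identity.

   The C^1 regularity of hit comes from hit (t, x) = hit (0, Phi (0, t, x)),
   where hit (0, _) is the inverse of the one-variable function
   r |-> Phi (0, r, 0), whose derivative never vanishes.  At fixed t, hit (t, _)
   maps [0, 1] decreasingly onto [t - tau t, t] with derivative of absolute
   value in [b0, b1]: the L^oo identity is the surjectivity, the L^p estimates
   are the change of variables. *)

Require Import Defs.
From HB Require Import structures.
From mathcomp Require Import all_boot all_order all_algebra.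
From mathcomp Require Import all_classical all_reals all_analysis.
From mathcomp Require Import measurable_realfun ess_sup_inf ring lra.

Set Implicit Arguments.
Unset Strict Implicit.
Unset Printing Implicit Defensive.

Import Order.TTheory GRing.Theory Num.Theory.
Import numFieldNormedType.Exports.

Local Open Scope classical_set_scope.
Local Open Scope ring_scope.

(** * Continuity on subsets, and differential calculus at a point *)

Lemma continuous_within_comp (T U V : topologicalType) (A : set T) (B : set U)
    (f : T -> U) (g : U -> V) :
  (forall x, A x -> B (f x)) -> {within A, continuous f} ->
  {within B, continuous g} -> {within A, continuous (g \o f)}.
Proof.
move=> AB /subspace_continuousP cf /subspace_continuousP cg.
apply/subspace_continuousP => x Ax P nP.
have nBP : nbhs (f x) (fun y => B y -> P (g y)) := cg _ (AB x Ax) P nP.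
have : nbhs x (fun z => A z -> B (f z) -> P (g (f z))) := cf x Ax _ nBP.
apply: (@filterS _ (nbhs x)) => z + Az; apply => //; exact: AB.
Qed.

Section differential_calculus.
Context {R : realType}.
Implicit Types U V W : normedModType R.

(** The first-order expansion of [f] at [x] only sees the germ of [f], so it is also one for [g];
    uniqueness of the differential then identifies ['d g x]. *)
Lemma near_eq_diff V W (f g : V -> W) x : (\near x, f x = g x) ->
  differentiable f x -> differentiable g x /\ 'd g x = 'd f x :> (V -> W).
Proof.
move=> fg /diff_locallyP[dfc dfx].
have dgx : g \o shift x = cst (g x) + 'd f x +o_ 0 id.
  apply/eqaddoP => _/posnumP[e].
  have /eqaddoP /(_ e%:num) /(_ [gt0 of e%:num]) := dfx.
  apply: filter_app; near=> h => /=.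
  rewrite /= (nbhs_singleton fg) !fctE /=.
  suff -> : g (h + x) = f (h + x) by [].
  apply/esym; near: h.
  have := fg; rewrite (near_shift 0 x) => fg'.
  by apply: filterS fg' => h /=; rewrite subr0.
have dg := diff_unique dfc dgx.
split; last exact: dg.
by apply/diff_locallyP; rewrite dg.
Unshelve. all: by end_near. Qed.

(** A pointwise form of [C1_on]. Differentiability is asked on a neighbourhood, so that the property
    depends on the germ only and the chain rule can be applied at all points near [x]. *)
Definition C1_at V W (f : V -> W) x :=
  (\forall y \near x, differentiable f y) /\
  forall h, {for x, continuous (fun y => 'D_h f y)}.

Lemma C1_atP V W (O : set V) (f : V -> W) : open O ->
  C1_on O f <-> forall x, O x -> C1_at f x.
Proof.
move=> oO; split=> [fC1 x Ox|fC1 x Ox]; last first.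
  by have [/nbhs_singleton] := fC1 x Ox.
split; last by move=> h; have [_] := fC1 x Ox.
have : nbhs x O by exact: open_nbhs_nbhs.
by apply: filterS => y /fC1[].
Qed.

Lemma near_eq_C1_at V W (f g : V -> W) x :
  (\near x, f x = g x) -> C1_at f x -> C1_at g x.
Proof.
move=> /near_join fg [df cf]; split.
  near=> y; apply: (near_eq_diff _ _).1; first exact: (near fg y).
  by near: y.
move=> h; rewrite /prop_for /continuous_at -(near_eq_derive h (nbhs_singleton fg)).
apply: cvg_trans (cf h); apply: near_eq_cvg; near=> y.
by apply: near_eq_derive; exact: (near fg y).
Unshelve. all: by end_near. Qed.

Lemma derive_precomp_affine U V W (a : U -> V) (f : V -> W) x h l :
  (forall k : R, a (k *: h + x) = k *: l + a x) ->
  'D_h (f \o a) x = 'D_l f (a x).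
Proof.
move=> ah; rewrite /derive; set d := (fun _ : R => _); set d' := (fun _ : R => _).
suff -> : d = d' by [].
by apply/funext => k; rewrite /d /d' /= ah.
Qed.

(** Here [l] is the linear part of [a]. The direction [l h] does not depend on the point, so
    continuity of each single directional derivative of [f] is enough. *)
Lemma C1_at_precomp_affine U V W (a l : U -> V) (f : V -> W) x :
  (forall y, differentiable a y) ->
  (forall y h (k : R), a (k *: h + y) = k *: l h + a y) ->
  C1_at f (a x) -> C1_at (f \o a) x.
Proof.
move=> da ah [df cf].
have ca : {for x, continuous a} by exact: differentiable_continuous.
split.
  have : \forall y \near x, differentiable f (a y) by exact: (ca _ df).
  by apply: filterS => y; exact: differentiable_comp.
move=> h.
have -> : (fun y => 'D_h (f \o a) y) = (fun y => 'D_(l h) f y) \o a.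
  by apply/funext => y; apply: derive_precomp_affine => k; exact: ah.
by apply: continuous_comp => //; exact: cf.
Qed.

Lemma C1_at_slice W (f : R * R -> W) t x :
  C1_at f (t, x) -> C1_at (fun y => f (t, y)) x.
Proof.
move=> fC1; apply: (@C1_at_precomp_affine R (R * R)%type W (fun y => (t, y))
  (fun y => (0, y)) f x) => [q|q h k|]; last exact: fC1.
  exact: differentiable_pair.
by congr (_, _) => /=; rewrite scaler0 add0r.
Qed.

(** With a scalar intermediate variable, the chain rule reads as a scalar multiple of ['D_1 g]; no
    derivative in a direction moving with the point appears. *)
Lemma C1_at_comp U W (f : U -> R) (g : R -> W) x :
  C1_at f x -> C1_at g (f x) -> C1_at (g \o f) x.
Proof.
move=> [df cf] [dg cg].
have cfx : {for x, continuous f}.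
  by apply: differentiable_continuous; exact: nbhs_singleton df.
have dgf : \forall y \near x, differentiable g (f y) by exact: (cfx _ dg).
split.
  by near=> y; apply: differentiable_comp; near: y.
move=> h.
have E : \forall y \near x, 'D_h f y *: 'D_1 g (f y) = 'D_h (g \o f) y.
  near=> y.
  have dfy : differentiable f y by near: y.
  have dgy : differentiable g (f y) by near: y.
  rewrite [RHS]deriveE; last exact: differentiable_comp.
  by rewrite diff_comp//= !deriveE// -linearZ/= [_ *: 1]mulr1.
rewrite /prop_for /continuous_at -(nbhs_singleton E).
apply: cvg_trans; first exact: (near_eq_cvg E).
apply: cvgZ; first exact: cf.
by apply: (@continuous_comp _ _ _ f (fun z => 'D_1 g z)) => //; exact: cg.
Unshelve. all: by end_near. Qed.

Lemma C1_at_continuous V W (f : V -> W) x : C1_at f x -> {for x, continuous f}.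
Proof. by move=> [/nbhs_singleton/differentiable_continuous]. Qed.

(** The chain rule along a graph. Applied to a characteristic, where [dy] is the speed, it produces
    the left-hand side of the transport equation. *)
Lemma is_derive_curve W (f : R * R -> W) (y : R -> R) t dy :
  differentiable f (t, y t) -> is_derive t 1 y dy ->
  is_derive t 1 (fun s => f (s, y s))
    ('D_(1, 0) f (t, y t) + dy *: 'D_(0, 1) f (t, y t)).
Proof.
move=> df dyt.
have dY : differentiable y t by apply/derivable1_diffP; case: dyt.
pose c := fun s => (s, y s).
have dc : differentiable c t by apply: differentiable_pair.
have dfc : differentiable (f \o c) t by exact: differentiable_comp.
apply: DeriveDef; first exact/derivable1_diffP.
rewrite deriveE// diff_comp//= diff_pair//= !deriveE// -linearZ -linearD /=.
have -> : 'd id t 1 = 1 by rewrite -deriveE// derive_id.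
have -> : 'd y t 1 = dy by rewrite -deriveE// derive_val.
congr ('d _ _ _).
by apply/eqP; rewrite xpair_eqE/= scaler0 addr0 add0r [_ *: _]mulr1 !eqxx.
Qed.

Lemma partial_tE W (f : R * R -> W) t x : partial_t f t x = 'D_(1, 0) f (t, x).
Proof.
rewrite /partial_t derive1E.
apply: (@derive_precomp_affine _ _ _ (fun s => (s, x)) f) => k.
by congr pair => /=; rewrite scaler0 add0r.
Qed.

Lemma partial_xE W (f : R * R -> W) t x : partial_x f t x = 'D_(0, 1) f (t, x).
Proof.
rewrite /partial_x derive1E.
apply: (@derive_precomp_affine _ _ _ (fun y => (t, y)) f) => k.
by congr pair => /=; rewrite scaler0 add0r.
Qed.

End differential_calculus.

Section product_projections.
Context {R : realType} (U V : normedModType R).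

Lemma differentiable_fst (p : U * V) : differentiable (fst : U * V -> U) p.
Proof.
have lf : linear (fst : U * V -> U) by [].
pose fM := GRing.isLinear.Build _ _ _ _ _ lf.
pose fL : {linear (U * V)%type -> U} := HB.pack (fst : U * V -> U) fM.
by apply: (@linear_differentiable _ _ _ fL) => q; exact: cvg_fst.
Qed.

Lemma differentiable_snd (p : U * V) : differentiable (snd : U * V -> V) p.
Proof.
have lf : linear (snd : U * V -> V) by [].
pose fM := GRing.isLinear.Build _ _ _ _ _ lf.
pose fL : {linear (U * V)%type -> V} := HB.pack (snd : U * V -> V) fM.
by apply: (@linear_differentiable _ _ _ fL) => q; exact: cvg_snd.
Qed.

End product_projections.

(** * Uniqueness for Lipschitz scalar differential equations *)

Section ode_uniqueness.
Context {R : realType}.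

(* With w = (y - z)^2, w exp(-2 L t) is nonincreasing and w exp(2 L t) is
   nondecreasing. *)
Lemma lipschitz_ode_unique (f : R * R -> R) (L : R) (y z : R -> R) (t0 : R) :
  (forall t a b, `|f (t, a) - f (t, b)| <= L * `|a - b|) ->
  (forall t : R, is_derive t 1 y (f (t, y t))) ->
  (forall t : R, is_derive t 1 z (f (t, z t))) ->
  y t0 = z t0 -> y =1 z.
Proof.
move=> lipf dy dz yz0 t.
pose w c s := (y s - z s) ^+ 2 * expR (c * s).
have dw (c s : R) : is_derive s 1 (w c)
    ((2 * (y s - z s) * (f (s, y s) - f (s, z s)) + c * (y s - z s) ^+ 2)
     * expR (c * s)).
  have dyz : is_derive s 1 (fun s => y s - z s) (f (s, y s) - f (s, z s)).
    exact: is_deriveB.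
  have dc : is_derive s 1 (fun s : R => c * s) c.
    by apply: is_derive_eq; rewrite scaler1.
  have de : is_derive s 1 (fun s : R => expR (c * s)) (expR (c * s) * c).
    exact: is_derive1_comp.
  have dM := is_deriveM (is_deriveM dyz dyz) de.
  have -> : w c = (fun s => y s - z s) * (fun s => y s - z s)
                  * (fun s => expR (c * s)) by [].
  apply: (is_derive_eq dM).
  rewrite /= !fctE /GRing.scale /=.
  ring.
have bnd (s : R) : `|2 * (y s - z s) * (f (s, y s) - f (s, z s))|
    <= 2 * L * (y s - z s) ^+ 2.
  rewrite -[_ ^+ 2]real_normK ?num_real// !normrM (ger0_norm (ler0n _ 2)).
  have -> : 2 * L * `|y s - z s| ^+ 2 = 2 * `|y s - z s| * (L * `|y s - z s|).
    by ring.
  by rewrite ler_wpM2l ?mulr_ge0.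
have cw (c a b : R) : {within `[a, b], continuous (w c)}.
  by apply: derivable_within_continuous => s _; case: (dw c s).
have w0 (c : R) : w c t0 = 0 by rewrite /w yz0 subrr expr0n/= mul0r.
suff [c wt] : exists c : R, w c t <= 0.
  apply/eqP; rewrite -subr_eq0 -sqrf_eq0 eq_le sqr_ge0 andbT.
  by rewrite -(pmulr_lle0 _ (expR_gt0 (c * t))).
have [t0t|/ltW tt0] := leP t0 t.
  exists (- (2 * L)); rewrite -(w0 (- (2 * L))).
  apply: (@ler0_derive1_nincr _ _ t0 t) => // s _.
  rewrite derive1E derive_val; apply: mulr_le0_ge0; last exact: expR_ge0.
  by rewrite mulNr subr_le0 (le_trans (ler_norm _))// bnd.
exists (2 * L); rewrite -(w0 (2 * L)).
apply: (@ger0_derive1_ndecr _ _ t t0) => // s _.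
rewrite derive1E derive_val; apply: mulr_ge0; last exact: expR_ge0.
by rewrite addrC -[X in _ + X]opprK subr_ge0 (le_trans _ (bnd s))// -normrN ler_norm.
Qed.

End ode_uniqueness.

(** * Monotonicity and regularity of the flow and of the hitting time *)

Section flow.
Context {R : realType} (lmin lmax L : R) (lam : R * R -> R).
Context (Hlam : admissible_speed lmin lmax L lam).
Context (Phi : R * R * R -> R) (HPhi : is_flow lam Phi).

Lemma speed_gt0 p : 0 < lam p.
Proof. by have [[lmin0 _ _ _ /(_ p)/andP[/(lt_le_trans lmin0)]]] := Hlam. Qed.

Lemma speed_lipschitz t a b : `|lam (t, a) - lam (t, b)| <= L * `|a - b|.
Proof.
wlog ab : a b / b <= a => [wl|].
  have [/wl//|/ltW/wl] := leP b a.
  by rewrite distrC [X in _ * X]distrC.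
have [_ [dlam _ blam]] := Hlam.
have dl (x : R) : is_derive x 1 (fun y => lam (t, y)) (partial_x lam t x).
  by rewrite /partial_x derive1E; exact/derivableP/dlam.
have [|c _ ->] := MVT_segment ab (fun x _ => dl x).
  by apply: derivable_within_continuous => s _; exact: dlam.
by rewrite normrM ler_wpM2r// ler_norml blam.
Qed.

Lemma flow_C1 p : C1_at Phi p.
Proof. by have [PhiC1 _] := HPhi; apply: (C1_atP _ openT).1. Qed.

Lemma flow_id t x : Phi (t, t, x) = x.
Proof. by have [_ /(_ t t x)[]] := HPhi. Qed.

Lemma flow_differentiable p : differentiable Phi p.
Proof. by have [/nbhs_singleton] := flow_C1 p. Qed.

Lemma is_derive_flow (s t x : R) :
  is_derive s 1 (fun r => Phi (r, t, x)) (lam (s, Phi (s, t, x))).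
Proof.
have [_ /(_ s t x)[<- _]] := HPhi; rewrite derive1E; apply/derivableP.
apply/derivable1_diffP.
apply: (@differentiable_comp _ _ _ _ (fun r => (r, t, x)) Phi).
  by apply: differentiable_pair => //; apply: differentiable_pair.
exact: flow_differentiable.
Qed.

(** As functions of [s], both sides solve the same Lipschitz equation and agree at [s = r]. *)
Lemma flow_comp s r t x : Phi (s, r, Phi (r, t, x)) = Phi (s, t, x).
Proof.
apply: (@lipschitz_ode_unique _ lam L (fun s => Phi (s, r, Phi (r, t, x)))
  (fun s => Phi (s, t, x)) r).
- exact: speed_lipschitz.
- by move=> u; exact: is_derive_flow.
- by move=> u; exact: is_derive_flow.
- by rewrite flow_id.
Qed.

Lemma flow_continuous_time t x : continuous (fun s => Phi (s, t, x)).
Proof.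
move=> s; apply: differentiable_continuous; apply/derivable1_diffP.
by case: (is_derive_flow s t x).
Qed.

Lemma flow_lt_time t x s1 s2 : s1 < s2 -> Phi (s1, t, x) < Phi (s2, t, x).
Proof.
move=> s12; apply: (@gtr0_derive1_incr _ (fun s => Phi (s, t, x)) s1 s2) => //.
- by move=> s _; case: (is_derive_flow s t x).
- move=> s _; rewrite derive1E; have := is_derive_flow s t x.
  by move=> ?; rewrite derive_val speed_gt0.
- exact/continuous_subspaceT/flow_continuous_time.
Qed.

Lemma flow_le_time t x s1 s2 : s1 <= s2 -> Phi (s1, t, x) <= Phi (s2, t, x).
Proof. by rewrite le_eqVlt => /predU1P[->//|/(flow_lt_time t x)/ltW]. Qed.

(** Characteristics do not cross: if the order were lost, the intermediate value theorem would give
    a time [r] at which the two meet, and flowing back from [r] to [t] would give [x1 = x2]. *)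
Lemma flow_lt_space s t x1 x2 : x1 < x2 -> Phi (s, t, x1) < Phi (s, t, x2).
Proof.
move=> x12; rewrite ltNge; apply/negP => le21.
pose D r := Phi (r, t, x2) - Phi (r, t, x1).
have Dt : 0 < D t by rewrite /D !flow_id subr_gt0.
have Ds : D s <= 0 by rewrite /D subr_le0.
have cD a b : {within `[a, b], continuous D}.
  apply: continuous_subspaceT => r.
  by apply: continuousB; exact: flow_continuous_time.
suff [r Dr] : exists r, D r = 0.
  have /(congr1 (fun y => Phi (t, r, y))) : Phi (r, t, x2) = Phi (r, t, x1).
    exact: subr0_eq.
  by rewrite !flow_comp !flow_id => x21; rewrite x21 ltxx in x12.
have [st|/ltW ts] := leP s t.
  have [|r _ Dr] := @IVT _ D s t 0 st (cD s t); last by exists r.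
  by rewrite ge_min le_max Ds (ltW Dt) orbT.
have [|r _ Dr] := @IVT _ D t s 0 ts (cD t s); last by exists r.
by rewrite ge_min le_max Ds (ltW Dt) orbT.
Qed.

(** At time [t2] the characteristic that left [x] at the earlier time [t1] is already beyond [x],
    and the flow preserves the order in space. *)
Lemma flow_gt_start s x t1 t2 : t1 < t2 -> Phi (s, t2, x) < Phi (s, t1, x).
Proof.
move=> t12; rewrite -[ltRHS](flow_comp s t2); apply: flow_lt_space.
by rewrite -[ltLHS](flow_id t1); exact: flow_lt_time.
Qed.

Lemma flow_slice_C1 s p : C1_at (fun q : R * R => Phi (s, q.1, q.2)) p.
Proof.
apply: (@C1_at_precomp_affine _ _ _ _ (fun q : R * R => (s, q.1, q.2))
  (fun q => (0, q.1, q.2))) => [q|q h k|].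
- apply: differentiable_pair; last exact: differentiable_snd.
  by apply: differentiable_pair => //; exact: differentiable_fst.
- by congr (_, _, _) => /=; rewrite scaler0 add0r.
- exact: flow_C1.
Qed.

Lemma flow_start_C1 s x t : C1_at (fun r => Phi (s, r, x)) t.
Proof.
apply: (@C1_at_precomp_affine _ _ _ _ (fun r => (s, r, x))
  (fun r => (0, r, 0))) => [q|q h k|].
- by apply: differentiable_pair => //; apply: differentiable_pair.
- by congr (_, _, _) => /=; rewrite scaler0 add0r.
- exact: flow_C1.
Qed.

(* Phi (s, r, Phi (r, t, x)) does not depend on r, and Phi (t, s, _) is a left
   inverse of Phi (s, t, _): hence the two partial derivatives satisfy
   d/dt = - lam * d/dx and d/dx does not vanish. *)
Lemma flow_start_neq0 (s t x : R) : 'D_1 (fun r => Phi (s, r, x)) t != 0.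
Proof.
pose F (q : R * R) := Phi (s, q.1, q.2).
have dF q : differentiable F q.
  by have [/nbhs_singleton] := flow_slice_C1 s q.
have -> : 'D_1 (fun r => Phi (s, r, x)) t = 'D_(1, 0) F (t, x).
  by rewrite -partial_tE /partial_t derive1E.
have key : 'D_(1, 0) F (t, x) + lam (t, x) *: 'D_(0, 1) F (t, x) = 0.
  have dPhi : is_derive t 1 (fun r => Phi (r, t, x)) (lam (t, x)).
    by have := is_derive_flow t t x; rewrite flow_id.
  have dFP : differentiable F (t, Phi (t, t, x)) by exact: dF.
  have := is_derive_curve dFP dPhi; rewrite flow_id => -[_ <-].
  have -> : (fun r => F (r, Phi (r, t, x))) = cst (Phi (s, t, x)).
    by apply/funext => r; rewrite /F/= flow_comp.
  by rewrite derive_cst.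
have dx0 : 'D_(0, 1) F (t, x) != 0.
  pose G y := Phi (t, s, y).
  have dG (y : R) : derivable G y 1.
    apply/derivable1_diffP/(@differentiable_comp _ _ _ _ (fun r => (t, s, r)) Phi).
      exact: differentiable_pair.
    exact: flow_differentiable.
  have dFx : derivable (fun y => F (t, y)) x 1.
    by apply/derivable1_diffP/(@differentiable_comp _ _ _ _ (fun r => (t, r)) F).
  apply/eqP => D0; have := derive1_comp dFx (dG _).
  have -> : G \o (fun y => F (t, y)) = id.
    by apply/funext => y; rewrite /F /G/= flow_comp flow_id.
  rewrite derive1_id -/(partial_x F t x) partial_xE D0 mulr0 => /eqP.
  by rewrite oner_eq0.
apply: contra dx0 => /eqP D0; move: key; rewrite D0 add0r => /eqP.
by rewrite scaler_eq0 (gt_eqF (speed_gt0 _)).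
Qed.

Context (hit : R * R -> R) (Hhit : is_hitting_time Phi hit).

Lemma hit_unique s t x : Phi (s, t, x) = 0 -> hit (t, x) = s.
Proof.
move=> P0; have := Hhit t x.
by have [/(flow_lt_time t x)|/(flow_lt_time t x)|//] := ltgtP (hit (t, x)) s;
  rewrite P0 => /[swap] ->; rewrite ltxx.
Qed.

Lemma hit_flow s t x : hit (s, Phi (s, t, x)) = hit (t, x).
Proof. by apply: hit_unique; rewrite flow_comp Hhit. Qed.

Lemma flow_hit s t x : Phi (s, hit (t, x), 0) = Phi (s, t, x).
Proof. by rewrite -(Hhit t x) flow_comp. Qed.

Lemma hit_x0 t : hit (t, 0) = t.
Proof. by apply: hit_unique; rewrite flow_id. Qed.

(** By [flow_hit], [Phi (t, _, 0)] recovers [x] from [hit (t, x)], and it is decreasing by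
    [flow_gt_start]. *)
Lemma hit_gt t x y : x < y -> hit (t, y) < hit (t, x).
Proof.
move=> xy; rewrite ltNge le_eqVlt; apply/negP => /orP[/eqP hxy|].
  move/(congr1 (fun s => Phi (t, s, 0))) : hxy.
  by rewrite !flow_hit !flow_id => yx; rewrite yx ltxx in xy.
move/(flow_gt_start t 0); rewrite !flow_hit !flow_id => yx.
by have := lt_trans xy yx; rewrite ltxx.
Qed.

Lemma hit_ge t x y : x <= y -> hit (t, y) <= hit (t, x).
Proof. by rewrite le_eqVlt => /predU1P[->//|/(hit_gt t)/ltW]. Qed.

(** Continuity of the inverse [h] comes first, from that of [g] alone. The inverse function rule
    then gives the derivative as the reciprocal of ['D_1 g (h x)], which is continuous because
    ['D_1 g] is continuous and never zero. *)
Lemma hit0_C1 y : C1_at (fun x => hit (0, x)) y.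
Proof.
pose g r := Phi (0, r, 0); pose h x := hit (0, x).
have gK : cancel g h by move=> r; rewrite /h /g hit_flow hit_x0.
have hK : cancel h g by move=> x; rewrite /h /g flow_hit flow_id.
have cg (x : R) : {for x, continuous g}.
  exact/C1_at_continuous/flow_start_C1.
have ch (x : R) : {for x, continuous h}.
  have gKn : {near h x, cancel g h} by apply: (@nearW _ (nbhs (h x))).
  have cgn : \forall r \near h x, {for r, continuous g}.
    by apply: (@nearW _ (nbhs (h x))).
  have := near_can_continuous gKn cgn.
  by rewrite hK => /nbhs_singleton.
have dh (x : R) : is_derive x 1 h ('D_1 g (h x))^-1.
  rewrite -{1}(hK x); apply: is_derive_inverse.
  - by apply: (@nearW _ (nbhs (h x))).
  - by apply: (@nearW _ (nbhs (h x))).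
  - apply/derivableP/derivable1_diffP.
    by have [/nbhs_singleton] := flow_start_C1 0 0 (h x).
  - exact: flow_start_neq0.
have dhx (x : R) : differentiable h x by apply/derivable1_diffP; case: (dh x).
split; first by apply: (@nearW _ (nbhs y)).
move=> k.
have -> : (fun x => 'D_k h x) = (fun x => k *: ('D_1 g (h x))^-1).
  apply/funext => x; rewrite -(@derive_val _ _ _ _ _ _ _ (dh x)).
  by rewrite !deriveE// -linearZ/= [_ *: 1]mulr1.
apply: cvgZ; first exact: cvg_cst.
apply: cvgV; first exact: flow_start_neq0.
apply: (@continuous_comp _ _ _ h (fun r => 'D_1 g r)); first exact: ch.
by have [_] := flow_start_C1 0 0 (h y); exact.
Qed.

Lemma hit_C1 p : C1_at hit p.
Proof.
have -> : hit = (fun x => hit (0, x)) \o (fun q => Phi (0, q.1, q.2)).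
  by apply/funext => -[t x]; rewrite /= hit_flow.
by apply: C1_at_comp; [exact: flow_slice_C1|exact: hit0_C1].
Qed.

Lemma hit_continuous : continuous hit.
Proof. by move=> p; exact/C1_at_continuous/hit_C1. Qed.

Lemma hit_le t x : 0 <= x -> hit (t, x) <= t.
Proof. by move=> x0; rewrite -[leRHS]hit_x0 hit_ge. Qed.

Context (T0 : R) (HT0 : Phi (- T0, 0, 1) = 0).

(** Since [- T0 = hit (0, 1)], transport [(t, x)] back to time 0: its position there is at most [x],
    hence at most 1, and [hit (0, _)] is decreasing. *)
Lemma hit_geNT0 t x : 0 <= t -> x <= 1 -> - T0 <= hit (t, x).
Proof.
move=> t0 x1; rewrite -(hit_unique HT0) -(hit_flow 0 t x); apply: hit_ge.
by rewrite (le_trans _ x1)// -[leRHS](flow_id t) flow_le_time.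
Qed.

Lemma hit_gtNT0 t x : 0 <= t -> x < 1 -> - T0 < hit (t, x).
Proof.
move=> t0 x1; rewrite -(hit_unique HT0) -(hit_flow 0 t x); apply: hit_gt.
by rewrite (le_lt_trans _ x1)// -[leRHS](flow_id t) flow_le_time.
Qed.

End flow.

(** * From the transport equation to the delay equation *)

Section classical_solution_to_delay.
Context {R : realType} (lmin lmax L : R) (lam : R * R -> R).
Context (Hlam : admissible_speed lmin lmax L lam).
Context (Phi : R * R * R -> R) (HPhi : is_flow lam Phi).
Context (hit : R * R -> R) (Hhit : is_hitting_time Phi hit).
Context (T0 : R) (HT0 : Phi (- T0, 0, 1) = 0).
Context (d : nat) (A : 'M[R]_d) (u0 : R -> 'cV[R]_d) (u : R * R -> 'cV[R]_d).
Context (Hu : classical_solution lam A u0 u).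

Lemma flow_0T0 : Phi (0, - T0, 0) = 1.
Proof. by rewrite -[in X in (_, X)]HT0 (flow_comp Hlam HPhi) (flow_id HPhi). Qed.

Lemma open_strip : open [set p : R * R | 0 < p.1 /\ 0 < p.2 < 1].
Proof.
have -> : [set p : R * R | 0 < p.1 /\ 0 < p.2 < 1] =
    fst @^-1` `]0, +oo[ `&` snd @^-1` `]0, 1[.
  apply/seteqP; split=> p /=; rewrite !in_itv/= andbT.
    by move=> [p0 p1]; rewrite p0 p1.
  by move=> [p0 p1]; rewrite p0 p1.
apply: openI; apply: open_comp => //.
  by move=> p _; exact: cvg_fst.
by move=> p _; exact: cvg_snd.
Qed.

Lemma classical_C1 p : 0 < p.1 -> 0 < p.2 < 1 -> C1_at u p.
Proof.
by have [_ uC1 _ _ _] := Hu => p1 p2; apply: (C1_atP _ open_strip).1.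
Qed.

(** The equation holds only in the open strip, while the endpoints of the characteristic may lie on
    its boundary. The mean value theorem fits: it needs the zero derivative on the open interval
    []a, b[] and mere continuity on [[a, b]]. *)
Lemma classical_characteristic a b t x : 0 <= a -> a <= b ->
  0 <= Phi (a, t, x) -> Phi (b, t, x) <= 1 ->
  u (a, Phi (a, t, x)) = u (b, Phi (b, t, x)).
Proof.
move=> a0 ab Pa Pb; have [cu _ pde _ _] := Hu.
pose c s := (s, Phi (s, t, x)).
have cc : continuous c.
  move=> s; have cP := @flow_continuous_time _ _ _ HPhi t x s.
  exact: (cvg_pair cvg_id cP).
have cuc : {within `[a, b], continuous (u \o c)}.
  apply: (continuous_within_comp _ _ cu); last exact: continuous_subspaceT.
  move=> s /=; rewrite in_itv/= => /andP[as_ sb].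
  rewrite (le_trans a0 as_) (le_trans Pa) ?(flow_le_time Hlam HPhi)//.
  by rewrite (le_trans _ Pb)// (flow_le_time Hlam HPhi).
have duc (s : R) : s \in `]a, b[ -> is_derive s 1 (u \o c) 0.
  rewrite in_itv/= => /andP[as_ sb].
  have s0 : 0 < s by exact: le_lt_trans as_.
  have Ps : 0 < Phi (s, t, x) < 1.
    rewrite (le_lt_trans Pa) ?(flow_lt_time Hlam HPhi)//.
    by rewrite (lt_le_trans _ Pb)// (flow_lt_time Hlam HPhi).
  rewrite -(pde _ _ s0 Ps) partial_tE partial_xE.
  apply: is_derive_curve; last exact: is_derive_flow.
  by have [/nbhs_singleton] := @classical_C1 (c s) s0 Ps.
(* The mean value theorem is for real functions, so it is applied to each entry. *)
apply/matrixP => i j.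
have dij (s : R) : s \in `]a, b[ -> is_derive s 1 (fun r => u (c r) i j) 0.
  move=> /duc[dc Dc]; move: Dc; rewrite derive_mx// => /matrixP/(_ i j).
  rewrite !mxE => D0; apply: DeriveDef => //.
  by move/derivable_mxP : dc; exact.
have [|e _] := MVT_segment ab dij; last first.
  by rewrite mul0r => /subr0_eq/esym.
apply: (@continuous_within_comp _ _ _ _ setT (u \o c)
  (fun M : 'cV[R]_d => M i j)) => //.
by apply: continuous_subspaceT => M; exact: coord_continuous.
Qed.

Context (v : R -> 'cV[R]_d) (Hv : v_from_u Phi T0 u0 u v).

(** Follow the characteristic backwards from [(t, x)]. If [hit (t, x)] is nonnegative, it reaches
    the boundary [x = 0], where [v] is the trace of [u]; otherwise it first reaches the initial line
    at [Phi (0, t, x)], which is where the definition of [v] at negative times evaluates [u0]. *)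
Lemma classical_u_from_v : u_from_v hit v u.
Proof.
move=> t x t0 /andP[x0 x1]; have [vpos vneg] := Hv; have [_ _ _ _ u_init] := Hu.
have hle := hit_le Hlam HPhi Hhit t x0.
have hge := hit_geNT0 Hlam HPhi Hhit HT0 t0 x1.
have [h0|h0] := leP 0 (hit (t, x)).
  rewrite vpos//.
  have := @classical_characteristic (hit (t, x)) t t x h0 hle.
  by rewrite Hhit (flow_id HPhi) lexx => /(_ isT x1) ->.
have P0 : 0 <= Phi (0, t, x).
  by rewrite -[leLHS](Hhit t x) (flow_le_time Hlam HPhi)// ltW.
have Px : Phi (0, t, x) <= x.
  by rewrite -[leRHS](flow_id HPhi t) (flow_le_time Hlam HPhi).
rewrite vneg ?hge// /X0/= (flow_hit Hlam HPhi Hhit) -u_init ?P0 ?(le_trans Px)//.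
have := @classical_characteristic 0 t t x (lexx _) t0 P0.
by rewrite (flow_id HPhi) => /(_ x1) ->.
Qed.

Lemma classical_continuous_solution :
  continuous_solution A T0 (tau hit) (fun t => u0 (X0 Phi (t, 0))) v.
Proof.
have [vpos vneg] := Hv; have [cu _ _ ubnd u_init] := Hu; split; last exact: vneg.
(* A single formula for v on both sides of 0: v s = u (f s), as Phi (0, s, 0)
   and s have opposite signs. *)
- pose f s := (Num.max s 0, Num.max (Phi (0, s, 0)) 0).
  have fS s : - T0 <= s -> 0 <= (f s).1 /\ 0 <= (f s).2 <= 1.
    move=> sT0; rewrite /f/= !le_max !lexx !orbT; split=> //=.
    rewrite ge_max ler01 andbT.
    have := sT0; rewrite le_eqVlt => /predU1P[<-|/(flow_gt_start Hlam HPhi 0 0)/ltW].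
      by rewrite flow_0T0.
    by move=> /le_trans; apply; rewrite flow_0T0.
  have vE s : - T0 <= s -> v s = u (f s).
    move=> sT0; rewrite /f; have [s0|s0] := leP 0 s.
      rewrite vpos//; congr (u (_, _)); apply/esym/max_r.
      by rewrite -[leRHS](flow_id HPhi s 0) (flow_le_time Hlam HPhi).
    have Ps : 0 <= Phi (0, s, 0).
      by rewrite -[leLHS](flow_id HPhi s 0) (flow_le_time Hlam HPhi)// ltW.
    rewrite max_l//; have := fS _ sT0; rewrite /f /= (max_l Ps) => -[_ P01].
    by rewrite vneg ?sT0// u_init.
  have cf : continuous f.
    move=> s.
    have cP : {for s, continuous (fun r => Phi (0, r, 0))}.
      exact/C1_at_continuous/(flow_start_C1 HPhi).
    have c0 : {for s, continuous (fun=> 0 : R)} by exact: cvg_cst.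
    have ci : {for s, continuous (fun r : R => r)} by exact: cvg_id.
    exact: (cvg_pair (continuous_max ci c0) (continuous_max cP c0)).
  apply: (@subspace_eq_continuous _ _ _ (u \o f)).
    by move=> s; rewrite inE/= in_itv/= andbT => /vE.
  apply: (continuous_within_comp _ _ cu); last exact: continuous_subspaceT.
  by move=> s /=; rewrite in_itv/= andbT; exact: fS.
(* The boundary condition gives [A *m u (t, 1)], and [u (t, 1)] is [v] at
   [hit (t, 1) = t - tau t]. *)
- move=> t t0; rewrite vpos// ubnd// classical_u_from_v ?ler01 ?lexx//.
  by rewrite /tau subKr.
Qed.

(* Near s, v is r |-> u (t, Phi (t, r, 0)) for any fixed time t at which the
   characteristic starting from x = 0 at time s is in the open interval. *)
Lemma classical_v_C1 : C1_on (`]- T0, +oo[ : set R) v.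
Proof.
apply/C1_atP; first exact: interval_open.
move=> s /=; rewrite in_itv/= andbT => sT0.
(* At time [m = max (s, 0)] the position is in [[0, 1[]: it is 0 if [s > 0], and otherwise it is
   below 1 because the start is later than [- T0]. Any time slightly after [m] works, as the
   position then becomes positive and remains below 1 by continuity. *)
have [t [t0 ts Pt]] : exists t, [/\ 0 < t, s < t & 0 < Phi (t, s, 0) < 1].
  pose m := Num.max s 0.
  have Pm0 : 0 <= Phi (m, s, 0).
    rewrite -[leLHS](flow_id HPhi s 0) (flow_le_time Hlam HPhi)//.
    by rewrite le_max lexx.
  have Pm1 : Phi (m, s, 0) < 1.
    rewrite /m; have [s0|s0] := leP s 0; last by rewrite (flow_id HPhi).
    have := flow_gt_start Hlam HPhi 0 0 sT0.
    by move=> /lt_le_trans; apply; rewrite flow_0T0.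
  have [t [mt Pt]] : exists t, m < t /\ Phi (t, s, 0) < 1.
    near m^'+ => t; exists t; split; first by near: t; exact: nbhs_right_gt.
    near: t; apply: (cvgr_lt (Phi (m, s, 0))) => //.
    apply: cvg_within_filter; exact: (flow_continuous_time HPhi).
  have [s_t t_0] : s < t /\ 0 < t by move: mt; rewrite gt_max => /andP[].
  exists t; split=> //; rewrite Pt andbT (le_lt_trans Pm0)//.
  exact: (flow_lt_time Hlam HPhi).
apply: (@near_eq_C1_at _ _ _ ((fun y => u (t, y)) \o (fun r => Phi (t, r, 0)))).
  have cP : {for s, continuous (fun r => Phi (t, r, 0))}.
    exact/C1_at_continuous/(flow_start_C1 HPhi).
  have : \forall y \near Phi (t, s, 0), y \in `]0, 1[.
    by apply: near_in_itvoo; rewrite in_itv.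
  move=> /cP; apply: (@filterS _ (nbhs s)) => r /=.
  rewrite in_itv/= => /andP[P0 P1].
  rewrite classical_u_from_v ?ltW//= ?(ltW P0) ?(ltW P1)//.
  by rewrite (hit_flow Hlam HPhi Hhit) (hit_x0 Hlam HPhi Hhit).
apply: C1_at_comp; first exact: (flow_start_C1 HPhi).
by apply: C1_at_slice; exact: classical_C1.
Unshelve. all: by end_near. Qed.

End classical_solution_to_delay.

(** * From the delay equation to the transport equation *)

Section delay_to_classical_solution.
Context {R : realType} (lmin lmax L : R) (lam : R * R -> R).
Context (Hlam : admissible_speed lmin lmax L lam).
Context (Phi : R * R * R -> R) (HPhi : is_flow lam Phi).
Context (hit : R * R -> R) (Hhit : is_hitting_time Phi hit).
Context (T0 : R) (HT0 : Phi (- T0, 0, 1) = 0).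
Context (d : nat) (A : 'M[R]_d) (v0 v u0 : R -> 'cV[R]_d) (u : R * R -> 'cV[R]_d).

Lemma delay_classical_solution :
  continuous_solution A T0 (tau hit) v0 v ->
  C1_on (`]- T0, +oo[ : set R) v -> u_from_v hit v u ->
  (forall x : R, 0 <= x <= 1 -> u0 x = v (hit (0, x))) ->
  classical_solution lam A u0 u.
Proof.
move=> [cv Dv _] vC1 uv u0v.
(* For [x < 1] the hitting time is strictly above [- T0], hence in the open interval where [v] is
   C^1. *)
have uC1 t x : 0 < t -> 0 < x < 1 -> C1_at u (t, x).
  move=> t0 x01; apply: (@near_eq_C1_at _ _ _ (v \o hit)).
    have : \forall p \near (t, x), [set p : R * R | 0 < p.1 /\ 0 < p.2 < 1] p.
      by apply: open_nbhs_nbhs; split => //; exact: open_strip.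
    apply: filterS => -[s y] [/= s0 /andP[y0 y1]].
    by rewrite uv ?ltW// (ltW y0) (ltW y1).
  apply: C1_at_comp; first exact: (hit_C1 Hlam HPhi Hhit).
  have oT0 : open (`]- T0, +oo[%classic : set R) by exact: interval_open.
  apply: (C1_atP _ oT0).1 => //=; rewrite in_itv/= andbT.
  by have /andP[_ x1] := x01; rewrite (hit_gtNT0 Hlam HPhi Hhit HT0) ?ltW.
split.
- apply: (@subspace_eq_continuous _ _ _ (v \o hit)).
    by move=> [t x]; rewrite inE => -[/= t0 x01]; rewrite /from_subspace uv.
  apply: (continuous_within_comp _ _ cv).
    move=> [t x] [/= t0 /andP[_ x1]]; rewrite in_itv/= andbT.
    exact: (hit_geNT0 Hlam HPhi Hhit HT0).
  apply: continuous_subspaceT; exact: (hit_continuous Hlam HPhi Hhit).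
- by apply/C1_atP; [exact: open_strip|move=> [t x] [/=]; exact: uC1].
- move=> t x t0 x01.
  have du : differentiable u (t, Phi (t, t, x)).
    by rewrite (flow_id HPhi); have [/nbhs_singleton] := uC1 _ _ t0 x01.
  (* The left-hand side of the equation is the derivative at [t] of [u] along the characteristic
     through [(t, x)]. For times near [t] this curve stays in the strip, where [u] equals
     [v \o hit], which is constant along it. *)
  have := is_derive_curve du (is_derive_flow HPhi t t x).
  rewrite (flow_id HPhi) partial_tE partial_xE => -[_ <-].
  rewrite -(derive_cst (v (hit (t, x))) t 1); apply: near_eq_derive.
  have cP : {for t, continuous (fun r => Phi (r, t, x))}.
    exact: (flow_continuous_time HPhi).
  have P01 : \forall y \near Phi (t, t, x), y \in `]0, 1[.
    by apply: near_in_itvoo; rewrite in_itv (flow_id HPhi).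
  near=> s.
  have s0 : 0 <= s.
    by near: s; apply: (@filterS _ (nbhs t)) (lt_nbhsr t0) => r /ltW.
  have : Phi (s, t, x) \in `]0, 1[ by near: s; exact: (cP _ P01).
  rewrite in_itv/= => /andP[P0 P1].
  by rewrite uv ?(ltW P0) ?(ltW P1)// (hit_flow Hlam HPhi Hhit).
- move=> t t0; rewrite !uv ?lexx ?ler01// (hit_x0 Hlam HPhi Hhit) Dv//.
  by rewrite /tau subKr.
- by move=> x x01; rewrite uv// u0v.
Unshelve. all: by end_near. Qed.

End delay_to_classical_solution.

(** * Norms on R^d, essential suprema and integrals under a change of variables *)

Section norms.
Context {R : realType}.
Local Notation mu := (@lebesgue_measure R).

(** Nonnegativity is derived from the axioms: [N 0 = 0] is at most [N y + N (- y)], which is twice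
    [N y]. *)
Lemma is_norm_ge0 d (N : 'cV[R]_d -> R) y : is_norm N -> 0 <= N y.
Proof.
move=> [tri hom _].
have N0 : N 0 = 0 by rewrite -(scale0r 0) hom normr0 mul0r.
have NN : N (- y) = N y by rewrite -scaleN1r hom normrN1 mul1r.
have := tri y (- y); rewrite subrr N0 NN; lra.
Qed.

(** Decomposition in the canonical basis bounds [N] by [C] times the sup norm, so [N] is
    Lipschitz. *)
Lemma is_norm_continuous d (N : 'cV[R]_d -> R) : is_norm N -> continuous N.
Proof.
move=> normN; have [tri hom _] := normN.
have N0 : N 0 = 0 by rewrite -(scale0r 0) hom normr0 mul0r.
pose C := \sum_(i < d) N (delta_mx i 0).
have C0 : 0 <= C by apply: sumr_ge0 => i _; exact: is_norm_ge0.
have NC y : N y <= C * `|y|.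
  rewrite {1}[y]matrix_sum_delta /C mulr_suml.
  elim/big_ind2 : _ => [|a x b z ax bz|i _]; first by rewrite N0.
    by rewrite (le_trans (tri _ _))// lerD.
  rewrite big_ord_recl big_ord0 addr0 hom mulrC.
  rewrite ler_wpM2l ?is_norm_ge0// /Num.Def.normr/= mx_normrE.
  exact: (le_bigmax _ (fun ij => `|y ij.1 ij.2|) (i, ord0)).
have NB y z : `|N y - N z| <= C * `|y - z|.
  have h a b : N a - N b <= C * `|a - b|.
    by rewrite lerBlDr -{1}(subrK b a) (le_trans (tri _ _))// lerD.
  by rewrite ler_norml h andbT lerNl opprB distrC h.
move=> y; apply/(@cvgrPdist_lt _ _ _ (nbhs y)) => e e0.
near=> z; apply: (le_lt_trans (NB _ _)).
(* Using [C + 1] keeps the divisor positive even if [C = 0]. *)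
apply: (@le_lt_trans _ _ ((C + 1) * `|y - z|)).
  by rewrite ler_wpM2r// lerDl.
rewrite mulrC -ltr_pdivlMr ?ltr_wpDl//.
near: z.
apply: (@cvgr_dist_lt _ _ _ (nbhs y) _ id y (@cvg_id _ (nbhs y))).
by rewrite divr_gt0 ?ltr_wpDl.
Unshelve. all: by end_near. Qed.

(** If the bound failed at one point, it would fail on a relative neighbourhood in [[a, b]]. Even at
    an endpoint, this contains a nonempty open interval []l, r[], whose positive measure contradicts
    the almost everywhere bound. *)
Lemma ae_le_within (w : R -> R) (a b : R) (y : \bar R) : a < b ->
  {within `[a, b], continuous w} ->
  (\forall x \ae mu, x \in `[a, b] -> ((w x)%:E <= y)%E) ->
  forall x, x \in `[a, b] -> ((w x)%:E <= y)%E.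
Proof.
move=> ab /subspace_continuousP cw [B [mB B0 wB]] x xab.
rewrite leNgt; apply/negP => ywx.
have : \forall z \near within `[a, b]%classic (nbhs x), (y < (w z)%:E)%E.
  case: y ywx {wB} => [r|//|_]; last by apply: nearW => z; rewrite ltNyr.
  rewrite lte_fin => rwx.
  exact: (cvgr_gt (w x) (cw x xab) _ rwx).
move=> /nbhs_ballP[e /= e0 be].
pose l := Num.max a (x - e); pose r := Num.min b (x + e).
move: xab; rewrite in_itv/= => /andP[ax xb].
have lr : l < r.
  rewrite /l /r lt_min !gt_max ab/= (le_lt_trans ax) ?ltrDl//=.
  by rewrite (lt_le_trans _ xb) ?gtrBl//=; lra.
have lrB : `]l, r[ `<=` B.
  move=> z /=; rewrite in_itv/= /l /r lt_min gt_max.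
    move=> /andP[/andP[az xz] /andP[zb zx]].
  have zab : z \in `[a, b] by rewrite in_itv/= !ltW.
  apply: wB => /= /(_ zab); apply/negP; rewrite -ltNge; apply: be => //.
  by rewrite /ball/= ltr_distlC xz zx.
have : (mu `]l, r[%classic <= mu B)%E by apply: le_measure => //; rewrite inE.
by rewrite B0 lebesgue_measure_itv/= lte_fin lr -EFinB lee_fin subr_le0 leNgt lr.
Qed.

(** By continuity, essential upper bounds are true upper bounds on the interval, so they depend on
    the range only. Equal ranges thus give the same set of essential upper bounds, and the same
    infimum. *)
Lemma Lnorm_infty_eq (w1 w2 : R -> R) (a1 b1 a2 b2 : R) :
  a1 < b1 -> a2 < b2 -> (forall x, 0 <= w1 x) -> (forall x, 0 <= w2 x) ->
  {within `[a1, b1], continuous w1} -> {within `[a2, b2], continuous w2} ->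
  (forall x, x \in `[a1, b1] -> exists2 y, y \in `[a2, b2] & w1 x = w2 y) ->
  (forall y, y \in `[a2, b2] -> exists2 x, x \in `[a1, b1] & w2 y = w1 x) ->
  ('N[mu]_+oo [(fun x => (w1 x)%:E) \_ `[a1, b1]] =
   'N[mu]_+oo [(fun x => (w2 x)%:E) \_ `[a2, b2]])%E.
Proof.
move=> ab1 ab2 w10 w20 cw1 cw2 w12 w21; rewrite unlock /Lnorm.
have ae_all (v1 v2 : R -> R) (c1 d1 c2 d2 : R) (y : \bar R) : c1 < d1 ->
    (forall x, 0 <= v1 x) -> (forall x, 0 <= v2 x) ->
    {within `[c1, d1], continuous v1} ->
    (forall x, x \in `[c2, d2] -> exists2 z, z \in `[c1, d1] & v2 x = v1 z) ->
    (\forall x \ae mu, ((abse \o (fun x => (v1 x)%:E) \_ `[c1, d1]) x <= y)%E) ->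
    \forall x \ae mu, ((abse \o (fun x => (v2 x)%:E) \_ `[c2, d2]) x <= y)%E.
  move=> cd1 v10 v20 cv1 v21 aev1.
  have v1y x : x \in `[c1, d1] -> ((v1 x)%:E <= y)%E.
    apply: ae_le_within => //.
    apply: (@filterS _ (almost_everywhere mu)) aev1 => z /= + zcd.
    by rewrite patchE mem_setE zcd/= ger0_norm.
  apply: nearW => x /=; rewrite patchE mem_setE; case: ifPn => [xcd|_].
    by have [z zcd v2x] := v21 x xcd; rewrite /= ger0_norm// v2x v1y.
  (* Outside [[c2, d2]] the extended function is 0, so [y] must be nonnegative: it is at least
     [v1 c1]. *)
  rewrite abse0 (le_trans _ (v1y c1 _)) ?lee_fin//.
  by rewrite in_itv/= lexx ltW.
by case: ifPn => // _; rewrite /ess_sup; congr ereal_inf; apply/seteqP; split=> y;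
  exact: ae_all.
Qed.

Lemma LpNormE d (N : 'cV[R]_d -> R) (p a b : R) (f : R -> 'cV[R]_d) :
  is_norm N -> 0 < p ->
  LpNorm N p%:E a b f =
  ((\int[mu]_(x in `[a, b]) (N (f x) `^ p)%:E) `^ p^-1)%E.
Proof.
move=> normN p0; rewrite /LpNorm unlock /Lnorm; congr (_ `^ _)%E.
rewrite [RHS]integral_mkcond; apply: eq_integral => x _.
rewrite !patchE; case: ifPn => _.
  by rewrite /= ger0_norm ?is_norm_ge0.
by rewrite abse0 poweR0r// gt_eqF.
Qed.

(* Not on the whole line: x `^ p is 1 for x < 0. *)
Lemma powR_continuous_nneg (p : R) : 0 < p ->
  {within `[0, +oo[, continuous (fun x : R => x `^ p)}.
Proof.
move=> p0; apply: derivable_oy_Rcontinuous_within_itvcy; split.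
  by move=> x x0; exact: derivable_powR.
by rewrite powR0 ?gt_eqF//; exact: powR_cvg0.
Qed.

(** With [q = p^-1], this lemma and [poweR_ge_scale] turn inequalities between integrals of p-th
    powers into inequalities between L^p norms. *)
Lemma poweR_le_scale (c q : R) (x y : \bar R) : 0 < c -> 0 <= q ->
  (0 <= x -> 0 <= y -> x <= c%:E * y -> (c `^ (- q))%:E * x `^ q <= y `^ q)%E.
Proof.
move=> c0 q0 x0 y0 xcy.
have cq : (c%:E `^ q = (c `^ q)%:E)%E by rewrite poweR_EFin.
have : (x `^ q <= (c `^ q)%:E * y `^ q)%E.
  rewrite -cq -poweRM ?lee_fin ?(ltW c0)//.
  apply: (gt0_ler_poweR q0) => //; rewrite in_itv/= ?x0 ?leey//.
  by rewrite mule_ge0// lee_fin ltW.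
have ck : (0 <= (c `^ (- q))%:E)%E by rewrite lee_fin powR_ge0.
move=> /(lee_wpmul2l ck); rewrite muleA -EFinM -powRD; last first.
  by rewrite (gt_eqF c0)/= implybT.
by rewrite addNr powRr0 mul1e.
Qed.

Lemma poweR_ge_scale (c q : R) (x y : \bar R) : 0 < c -> 0 <= q ->
  (0 <= x -> 0 <= y -> c%:E * y <= x -> y `^ q <= (c `^ (- q))%:E * x `^ q)%E.
Proof.
move=> c0 q0 x0 y0 cyx.
have cq : (c%:E `^ q = (c `^ q)%:E)%E by rewrite poweR_EFin.
have : ((c `^ q)%:E * y `^ q <= x `^ q)%E.
  rewrite -cq -poweRM ?lee_fin ?(ltW c0)//.
  apply: (gt0_ler_poweR q0) => //; rewrite in_itv/= ?x0 ?leey//.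
  by rewrite mule_ge0// lee_fin ltW.
have ck : (0 <= (c `^ (- q))%:E)%E by rewrite lee_fin powR_ge0.
move=> /(lee_wpmul2l ck); rewrite muleA -EFinM -powRD; last first.
  by rewrite (gt_eqF c0)/= implybT.
by rewrite addNr powRr0 mul1e.
Qed.

(** The substitution turns the middle integral into that of [G (F x) * - F' x] over [[a, b]], and
    the weight [- F'] lies between [k0] and [k1]. *)
Lemma substitution_bounds (F G : R -> R) (a b k0 k1 : R) : a < b ->
  {in `[a, b] &, {homo F : x y /~ x < y}} ->
  (forall x, derivable F x 1) -> continuous (derive1 F) ->
  (forall x, a < x < b -> k0 <= `|derive1 F x| <= k1) -> 0 <= k0 -> 0 <= k1 ->
  {within `[F b, F a], continuous G} -> (forall x, 0 <= G x) ->
  (k0%:E * \int[mu]_(x in `[a, b]) (G (F x))%:E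
     <= \int[mu]_(x in `[F b, F a]) (G x)%:E
     <= k1%:E * \int[mu]_(x in `[a, b]) (G (F x))%:E)%E.
Proof.
move=> ab decF dF cF' bF k0_ge0 k1_ge0 cG G0.
have cF x : {for x, continuous F}.
  by apply/differentiable_continuous/derivable1_diffP.
have F'le0 x : a < x < b -> derive1 F x <= 0.
  move=> xab; apply: (@decr_derive1_le0_itv _ F true false a b x _ decF) => //.
(* The bounds are assumed in the open interval only; they pass to [a] and [b] by continuity of
   [F']. *)
have bF' x : x \in `[a, b] -> k0 <= - derive1 F x <= k1.
  move=> xab; pose H := fun z => - derive1 F z.
  have cH : continuous H by move=> z; apply: continuousN; exact: cF'.
  have HE z : a < z < b -> k0 <= H z <= k1.
    by move=> zab; rewrite /H -ler0_norm ?F'le0// bF.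
  (* [G'] is a one-sided approach to [x] from within []a, b[]: from the left if [x = b], from the
     right otherwise. *)
  have [G' [PG' cG' nG']] : exists G' : set_system R,
      [/\ ProperFilter G', H z @[z --> G'] --> H x & \forall z \near G', a < z < b].
    move: xab; rewrite in_itv/= => /andP[ax]; rewrite le_eqVlt => /predU1P[->|xb].
      exists b^'-; split; first exact: at_left_proper_filter.
        exact/cvg_at_left_filter/cH.
      near=> z; apply/andP.
      by split; near: z; [exact: nbhs_left_gt|exact: nbhs_left_lt].
    exists x^'+; split; first exact: at_right_proper_filter.
      exact/cvg_at_right_filter/cH.
    near=> z; rewrite (le_lt_trans ax)/=; first by near: z; exact: nbhs_right_lt.
    by near: z; exact: nbhs_right_gt.
  apply/andP; split.
    by apply: (cvgr_to_ge cG'); apply: filterS nG' => z /HE/andP[].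
  by apply: (cvgr_to_le cG'); apply: filterS nG' => z /HE/andP[].
rewrite (@integration_by_substitution_decreasing _ F G a b) ?(ltW ab)//; first last.
- split.
  + by move=> x _.
  + exact/cvg_at_right_filter/cF.
  + exact/cvg_at_left_filter/cF.
- apply/cvg_ex; eexists; exact/cvg_at_left_filter/cF'.
- apply/cvg_ex; eexists; exact/cvg_at_right_filter/cF'.
have cGF : {within `[a, b], continuous (G \o F)}.
  apply: (continuous_within_comp _ _ cG); last exact: continuous_subspaceT.
  have ltW_F x y : x \in `[a, b] -> y \in `[a, b] -> x <= y -> F y <= F x.
    move=> xab yab; rewrite le_eqVlt => /predU1P[->//|xy].
    by rewrite ltW// decF.
  move=> x xab; have /andP[ax xb] : a <= x <= b by move: xab; rewrite /= in_itv.
  by rewrite /= in_itv/= !ltW_F ?in_itv/= ?lexx ?ax ?xb ?(ltW ab).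
have mGF : measurable_fun `[a, b] (G \o F).
  exact: subspace_continuous_measurable_fun.
have mGF' : measurable_fun `[a, b] ((G \o F) * - derive1 F)%R.
  apply: measurable_funM => //; apply: subspace_continuous_measurable_fun => //.
  by apply: continuous_subspaceT => x; apply: continuousN; exact: cF'.
have mEGF : measurable_fun `[a, b] (EFin \o (G \o F)) by exact/measurable_EFinP.
have mEGF' : measurable_fun `[a, b] (EFin \o ((G \o F) * - derive1 F)%R).
  exact/measurable_EFinP.
rewrite -!ge0_integralZl_EFin//; try by move=> x _; rewrite lee_fin.
apply/andP; split; apply: ge0_le_integral => //=.
- by move=> x _; rewrite lee_fin mulr_ge0.
- exact: measurable_funeM.
- move=> x xab; rewrite -EFinM lee_fin mulrC ler_wpM2l//.
  by have /andP[] := bF' x xab.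
- move=> x xab; rewrite lee_fin mulr_ge0//= ?G0//.
  by have /andP[h _] := bF' x xab; exact: (le_trans k0_ge0 h).
- exact: measurable_funeM.
- move=> x xab; rewrite -EFinM lee_fin [leRHS]mulrC ler_wpM2l//= ?G0//.
  by have /andP[] := bF' x xab.
Unshelve. all: by end_near. Qed.

End norms.

(** * Comparison of the norms of [u] and [v] *)

Section norm_comparison.
Context {R : realType} (lmin lmax L : R) (lam : R * R -> R).
Context (Hlam : admissible_speed lmin lmax L lam).
Context (Phi : R * R * R -> R) (HPhi : is_flow lam Phi).
Context (hit : R * R -> R) (Hhit : is_hitting_time Phi hit).
Context (T0 : R) (HT0 : Phi (- T0, 0, 1) = 0).
Context (d : nat) (N : 'cV[R]_d -> R) (normN : is_norm N).
Context (u : R * R -> 'cV[R]_d) (v : R -> 'cV[R]_d).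
Context (cv : {within `[- T0, +oo[, continuous v}) (uv : u_from_v hit v u).
Context (t : R) (t0 : 0 <= t).

Lemma tau_gt0 : 0 < tau hit t.
Proof.
rewrite /tau subr_gt0 -[ltRHS](hit_x0 Hlam HPhi Hhit).
by rewrite (hit_gt Hlam HPhi Hhit).
Qed.

(** The shift by [t] makes [F] take its values in the domain of the history s |-> v (t + s). *)
Let F x := hit (t, x) - t.

Let F0 : F 0 = 0. Proof. by rewrite /F (hit_x0 Hlam HPhi Hhit) subrr. Qed.

Let F1 : F 1 = - tau hit t. Proof. by rewrite /F /tau opprB. Qed.

Let FC1 x : C1_at (fun y => hit (t, y)) x.
Proof. by apply: C1_at_slice; exact: (hit_C1 Hlam HPhi Hhit). Qed.

Let dhit (x : R) : derivable (fun y => hit (t, y)) x 1.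
Proof. by apply/derivable1_diffP; have [/nbhs_singleton] := FC1 x. Qed.

Let dF (x : R) : derivable F x 1.
Proof. by apply: derivableB. Qed.

Let F'E : derive1 F = partial_x hit t.
Proof.
apply/funext => x; rewrite /partial_x !derive1E /F.
have -> : (fun x => hit (t, x) - t) = (fun x => hit (t, x)) - cst t by [].
by rewrite deriveB// derive_cst subr0.
Qed.

Let cF : continuous F.
Proof. by move=> x; apply/differentiable_continuous/derivable1_diffP. Qed.

Let decF : {in `[0, 1] &, {homo F : x y /~ x < y}}.
Proof. by move=> x y _ _ xy; rewrite /F ltrD2r (hit_gt Hlam HPhi Hhit). Qed.

Let FS x : x \in `[0, 1] -> F x \in `[- tau hit t, 0].
Proof.
rewrite !in_itv/= => /andP[x0 x1]; rewrite -F1 -F0 /F !lerD2r.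
by rewrite !(hit_ge Hlam HPhi Hhit).
Qed.

Let Fsurj s : s \in `[- tau hit t, 0] -> exists2 x, x \in `[0, 1] & s = F x.
Proof.
(* The preimage of [s] is the position at time [t] of the characteristic that is at 0 at time
   [t + s]. *)
rewrite in_itv/= => /andP[s1 s0]; pose x := Phi (t, t + s, 0).
have sF : s = F x.
  rewrite /F /x (hit_flow Hlam HPhi Hhit) (hit_x0 Hlam HPhi Hhit).
  by rewrite addrAC subrr add0r.
exists x => //; rewrite in_itv/= !leNgt; apply/andP; split; apply/negP.
  move/(hit_gt Hlam HPhi Hhit t); rewrite -(ltrD2r (- t)) -/(F _) -/(F _) F0 -sF.
  by rewrite ltNge s0.
move/(hit_gt Hlam HPhi Hhit t); rewrite -(ltrD2r (- t)) -/(F _) -/(F _) F1 -sF.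
by rewrite ltNge s1.
Qed.

Let w s := N (v (t + s)).

Let cw : {within `[- tau hit t, 0], continuous w}.
Proof.
apply: (@continuous_within_comp _ _ _ _ setT (fun s => v (t + s)) N) => //;
  last first.
  exact/continuous_subspaceT/is_norm_continuous.
apply: (@continuous_within_comp _ _ _ _ _ (fun s => t + s) v _ _ cv).
  move=> s /=; rewrite !in_itv/= andbT => /andP[s1 _].
  have := hit_geNT0 Hlam HPhi Hhit HT0 t0 (lexx 1); move: s1.
  rewrite /tau; lra.
apply: continuous_subspaceT => s; apply: cvgD; [exact: cvg_cst|exact: cvg_id].
Qed.

Let uw x : x \in `[0, 1] -> N (u (t, x)) = w (F x).
Proof. by rewrite in_itv/= => x01; rewrite /w /F uv// addrC subrK. Qed.

Let cwF : {within `[0, 1], continuous (w \o F)}.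
Proof.
apply: (continuous_within_comp _ _ cw); last exact: continuous_subspaceT.
by move=> x /=; exact: FS.
Qed.

Lemma LpNorm_infty_hit :
  LpNorm N +oo%E 0 1 (fun x => u (t, x)) =
  LpNorm N +oo%E (- tau hit t) 0 (fun s => v (t + s)).
Proof.
rewrite /LpNorm; apply: (@Lnorm_infty_eq _ (fun x => N (u (t, x))) w).
- exact: ltr01.
- by rewrite oppr_lt0 tau_gt0.
- by move=> x; exact: is_norm_ge0.
- by move=> x; exact: is_norm_ge0.
- apply: subspace_eq_continuous cwF => x; rewrite inE/= => x01.
  by rewrite /from_subspace uw.
- exact: cw.
- by move=> x x01; exists (F x); [exact: FS|exact: uw].
- by move=> s /Fsurj[x x01 ->]; exists x => //; rewrite uw.
Qed.

Context (b0 b1 : R) (b0_gt0 : 0 < b0) (b1_gt0 : 0 < b1).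
Context (Hb : forall x : R, 0 < x < 1 -> b0 <= `|partial_x hit t x| <= b1).

Lemma LpNorm_hit (p : R) : 1 <= p ->
  ((b1 `^ (- p^-1))%:E * LpNorm N p%:E (- tau hit t) 0 (fun s => v (t + s))%R
     <= LpNorm N p%:E 0 1 (fun x => u (t, x)))%E /\
  (LpNorm N p%:E 0 1 (fun x => u (t, x))
     <= (b0 `^ (- p^-1))%:E *
        LpNorm N p%:E (- tau hit t) 0 (fun s => v (t + s))%R)%E.
Proof.
move=> p1; have p0 : 0 < p by exact: lt_le_trans p1.
rewrite !LpNormE//.
have -> : (\int[@lebesgue_measure R]_(x in `[0%R, 1%R]) (N (u (t, x)) `^ p)%:E =
    \int[@lebesgue_measure R]_(x in `[0%R, 1%R]) (w (F x) `^ p)%:E)%E.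
  by apply: eq_integral => x; rewrite inE/= => x01; rewrite uw.
have cF' : continuous (derive1 F).
  move=> x; rewrite F'E.
  have -> : partial_x hit t = (fun y => 'D_1 (fun y => hit (t, y)) y).
    by apply/funext => y; rewrite /partial_x derive1E.
  by have [_] := FC1 x; exact.
have bF x : 0 < x < 1 -> b0 <= `|derive1 F x| <= b1 by rewrite F'E; exact: Hb.
have cG : {within `[F 1, F 0], continuous (fun s => w s `^ p)}.
  rewrite F1 F0; apply: (continuous_within_comp _ cw (powR_continuous_nneg p0)).
  by move=> s _ /=; rewrite in_itv/= andbT is_norm_ge0.
have := @substitution_bounds _ F (fun s => w s `^ p) 0 1 b0 b1 ltr01 decF dF
  cF' bF (ltW b0_gt0) (ltW b1_gt0) cG (fun s => powR_ge0 _ _).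
rewrite F1 F0 => /andP[lb ub].
have p'0 : 0 <= p^-1 by rewrite invr_ge0 ltW.
have Iv_ge0 : (0 <= \int[@lebesgue_measure R]_(s in `[(- tau hit t)%R, 0%R])
    (w s `^ p)%:E)%E by apply: integral_ge0 => s _; rewrite lee_fin powR_ge0.
have Iu_ge0 : (0 <= \int[@lebesgue_measure R]_(x in `[0%R, 1%R])
    (w (F x) `^ p)%:E)%E by apply: integral_ge0 => x _; rewrite lee_fin powR_ge0.
(* The two bounds swap roles: the upper bound [b1] on the derivative of [F] gives the lower estimate
   for [u], and the lower bound [b0] the upper one. *)
split; first exact: (poweR_le_scale b1_gt0 p'0 Iv_ge0 Iu_ge0 ub).
exact: (poweR_ge_scale b0_gt0 p'0 Iv_ge0 Iu_ge0 lb).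
Qed.

End norm_comparison.

Theorem proposition6p7 (R : realType) (d : nat) (d_gt0 : (0 < d)%N)
  (N : 'cV[R]_d -> R) (normN : is_norm N)
  (A : 'M[R]_d)
  (lmin lmax L : R) (lam : R * R -> R)
  (Hlam : admissible_speed lmin lmax L lam)
  (Phi : R * R * R -> R) (HPhi : is_flow lam Phi)
  (T0 : R) (T0_gt0 : 0 < T0) (HT0 : Phi (- T0, 0, 1) = 0)
  (hit : R * R -> R) (Hhit : is_hitting_time Phi hit)
  (b0 b1 : R) (b0_gt0 : 0 < b0) (b1_gt0 : 0 < b1)
  (Hb : forall t x : R, 0 <= t -> 0 < x < 1 ->
     b0 <= `|partial_x hit t x| <= b1) :
  [/\ (forall (u0 : R -> 'cV[R]_d) (u : R * R -> 'cV[R]_d) (v : R -> 'cV[R]_d),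
         classical_solution lam A u0 u ->
         v_from_u Phi T0 u0 u v ->
         continuous_solution A T0 (tau hit) (fun t => u0 (X0 Phi (t, 0))) v /\
         C1_on (`]- T0, +oo[ : set R) v),
      (forall (v0 v : R -> 'cV[R]_d) (u0 : R -> 'cV[R]_d)
              (u : R * R -> 'cV[R]_d),
         continuous_solution A T0 (tau hit) v0 v ->
         C1_on (`]- T0, +oo[ : set R) v ->
         u_from_v hit v u ->
         (forall x : R, 0 <= x <= 1 -> u0 x = v (hit (0, x))) ->
         classical_solution lam A u0 u) &
      (forall (u : R * R -> 'cV[R]_d) (v : R -> 'cV[R]_d),
         (exists u0 : R -> 'cV[R]_d,
            classical_solution lam A u0 u /\ v_from_u Phi T0 u0 u v) \/
         (exists v0 : R -> 'cV[R]_d,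
            [/\ continuous_solution A T0 (tau hit) v0 v,
                C1_on (`]- T0, +oo[ : set R) v & u_from_v hit v u]) ->
         forall t : R, 0 <= t ->
           LpNorm N +oo%E 0 1 (fun x => u (t, x)) =
             LpNorm N +oo%E (- tau hit t) 0 (fun s => v (t + s)) /\
           forall p : R, 1 <= p ->
             ((b1 `^ (- p^-1))%:E *
                LpNorm N p%:E (- tau hit t) 0 (fun s => v (t + s))%R
              <= LpNorm N p%:E 0 1 (fun x => u (t, x)))%E /\
             (LpNorm N p%:E 0 1 (fun x => u (t, x))
              <= (b0 `^ (- p^-1))%:E *
                 LpNorm N p%:E (- tau hit t) 0 (fun s => v (t + s))%R)%E)].

Proof.
split.
- move=> u0 u v Hu Hv; split.
    exact: (classical_continuous_solution Hlam HPhi Hhit HT0 Hu Hv).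
  exact: (classical_v_C1 Hlam HPhi Hhit HT0 Hu Hv).
- move=> v0 v u0 u Hv vC1 uv u0v.
  exact: (delay_classical_solution Hlam HPhi Hhit HT0 Hv vC1 uv u0v).
- move=> u v uv t t0.
  (* Whichever way [u] and [v] are related, the comparison uses only these two facts. *)
  have [cv {}uv] : {within `[- T0, +oo[, continuous v} /\ u_from_v hit v u.
    case: uv => [[u0 [Hu Hv]]|[v0 [[cv _ _] _ uv]]]; last by split.
    split; last exact: (classical_u_from_v Hlam HPhi Hhit HT0 Hu Hv).
    by have [] := classical_continuous_solution Hlam HPhi Hhit HT0 Hu Hv.
  split; first exact: (LpNorm_infty_hit Hlam HPhi Hhit HT0 normN cv uv t0).
  move=> p p1.
  apply: (LpNorm_hit Hlam HPhi Hhit HT0 normN cv uv t0 b0_gt0 b1_gt0 _ p1).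
  by move=> x; exact: Hb.
Qed.
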